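(* Let $n=5$. All $30$ kernel-free MLS on $[5]$ attaining the second level (that is, the value $\Lambda(M)=63$, the maximum of $\Lambda$ over kernel-free MLS on $[5]$ other than the five one-flip stars $\mathcal F_a^{*}$) have one and the same layer profile $$(f_1,f_2,f_3,f_4,f_5)=(0,3,7,5,1),$$ yet they split into two non-isomorphic types: in the $20$ systems $U_{a,B}$ ($a\in[5]$, $B\subseteq[5]\setminus\{a\}$, $|B|=3$) the three $2$-sets form a star $K_{1,3}$, while in the $10$ balls $\mathcal A_T$ ($T\in\binom{[5]}{3}$) they form a triangle. Consequently no function of the layer profile alone (in particular no profile-polytope or Kruskal–Katona-type argument) can separate the two types or produce the second-level equality classification (stated in the context).
   Context: $[n]=\{1,\dots,n\}$; $V_n$ is the set of nonempty subsets of $[n]$; $\binom{X}{k}$ is the set of $k$-element subsets of $X$. A family $\mathcal F\subseteq V_n$ is intersecting if $A\cap B\ne\varnothing$ for all $A,B\in\mathcal F$. A maximal linked system (MLS) on $[n]$ is an inclusion-maximal intersecting family $\mathcal F\subseteq V_n$. A family is kernel-free if $\bigcap_{S\in\mathcal F}S=\varnothing$. $\Lambda(\mathcal F)=\sum_{S\in\mathcal F}2^{n-|S|}$. The layer profile of $M$ is $(f_1,\dots,f_n)$ with $f_k=|\{S\in M:|S|=k\}|$. $\mathrm{Star}(a)=\{S\in V_n:a\in S\}$, and the one-flip star is $\mathcal F_a^{*}=(\mathrm{Star}(a)\setminus\{\{a\}\})\cup\{[n]\setminus\{a\}\}$. For $i\in[n]$ and $B\subseteq[n]\setminus\{i\}$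 with $|B|\ge2$, $U_{i,B}=\{S\subseteq[n]:i\in S,\ S\cap B\ne\varnothing\}\cup\{S\subseteq[n]:i\notin S,\ B\subseteq S\}$. For $T\in\binom{[5]}{3}$, $\mathcal A_T=\{S\subseteq[5]:|S\cap T|\ge2\}$. A star $K_{1,3}$ means three $2$-sets sharing a common element; a triangle means the three $2$-subsets of a $3$-set. Two families on $[n]$ are isomorphic if a permutation of $[n]$ carries one to the other. The second-level equality classification is the following: for $n\ge5$, every kernel-free MLS $M$ on $[n]$ with $M\ne\mathcal F_a^{*}$ for all $a\in[n]$ satisfies $\Lambda(M)\le3^{n-1}-3\cdot2^{n-2}+6$, with equality precisely for the $n(n-1)$ systems $U_{a,B}$ with $|B|=n-2$ and, when $n=5$ only, in addition for the $10$ balls $\mathcal A_T$, $T\in\binom{[5]}{3}$. *)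

(* Defs.v *)
From mathcomp Require Import all_boot all_fingroup.

Set Implicit Arguments.
Unset Strict Implicit.
Unset Printing Implicit Defensive.

(* The ground set [n] is 'I_n, that is {0, ..., n-1}. *)

Section Families.

Variable n : nat.

Implicit Types (S T B : {set 'I_n}) (F M N E : {set {set 'I_n}}) (a i : 'I_n).

Definition Vn : {set {set 'I_n}} := [set S : {set 'I_n} | S != set0].

Definition intersecting F : bool :=
  (F \subset Vn) && [forall A in F, forall B in F, (A :&: B != set0)].

Definition is_mls F : bool := maxset intersecting F.

Definition kernel_free F : bool := \bigcap_(S in F) S == set0.

Definition Lambda F : nat := \sum_(S in F) 2 ^ (n - #|S|).

Definition layer F (k : nat) : {set {set 'I_n}} := [set S in F | #|S| == k].

(* Indices of 'I_n start at 0, whence the shift: (f_1, ..., f_n). *)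
Definition profile F : n.-tuple nat := [tuple #|layer F k.+1| | k < n].

Definition Star a : {set {set 'I_n}} := [set S in Vn | a \in S].

Definition flip_star a : {set {set 'I_n}} :=
  (Star a :\ [set a]) :|: [set ~: [set a]].

Definition flip_stars : {set {set {set 'I_n}}} := [set flip_star a | a : 'I_n].

(* Meaningful when i \notin B and 2 <= #|B|. *)
Definition U_sys i B : {set {set 'I_n}} :=
  [set S : {set 'I_n} | (i \in S) && (S :&: B != set0)]
    :|: [set S : {set 'I_n} | (i \notin S) && (B \subset S)].

Definition U_systems (k : nat) : {set {set {set 'I_n}}} :=
  [set M | [exists i, exists B : {set 'I_n},
     [&& B \subset ~: [set i], #|B| == k & M == U_sys i B]]].

Definition ball T : {set {set 'I_n}} := [set S : {set 'I_n} | 2 <= #|S :&: T|].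

Definition balls : {set {set {set 'I_n}}} :=
  [set M | [exists T : {set 'I_n}, (#|T| == 3) && (M == ball T)]].

Definition second_level_value : nat :=
  \max_(M : {set {set 'I_n}} |
        [&& is_mls M, kernel_free M & M \notin flip_stars]) Lambda M.

Definition second_level : {set {set {set 'I_n}}} :=
  [set M | [&& is_mls M, kernel_free M & Lambda M == second_level_value]].

Definition is_star3 E : Prop :=
  [/\ #|E| = 3, (forall S, S \in E -> #|S| = 2)
    & exists a : 'I_n, forall S, S \in E -> a \in S].

Definition is_triangle E : Prop :=
  exists2 T : {set 'I_n}, #|T| = 3 & E = [set S : {set 'I_n} | (S \subset T) && (#|S| == 2)].

Definition isomorphic M N : Prop :=
  exists s : {perm 'I_n}, N = [set [set s x | x in S] | S : {set 'I_n} in M].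

Definition profile_recognises (C : {set {set {set 'I_n}}})
    (P : n.-tuple nat -> Prop) : Prop :=
  forall M, M \in second_level -> (P (profile M) <-> M \in C).

Definition profile_classifies (g : n.-tuple nat -> {set {set 'I_n}}) : Prop :=
  forall M, M \in second_level -> isomorphic M (g (profile M)).

End Families.
Arguments flip_stars : clear implicits.
Arguments U_systems : clear implicits.
Arguments balls : clear implicits.
Arguments second_level_value : clear implicits.
Arguments second_level : clear implicits.

(* Main.v *)
(* An intersecting family is an MLS as soon as it meets every complementary
   pair {S, ~: S}, and an MLS contains exactly one set of each such pair.  On
   five points this leaves f_2 as the only free entry of the profile of a
   kernel-free MLS: f_1 = 0, f_4 = 5, f_5 = 1, f_3 = 10 - f_2, so that
   Lambda = 51 + 4 f_2.  The 2-sets of M pairwise meet, hence if there are at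
   least three of them they form a triangle, which generates a ball A_T, or they
   are the pairs {a, b} with b in some B, and then M = U_{a,B}, because B itself
   belongs to M.  The case |B| = 4 is that of the flip stars, and the second
   level is f_2 = 3. *)
Require Import Defs.
From mathcomp Require Import all_boot all_fingroup.
From mathcomp Require Import zify.

Set Implicit Arguments.
Unset Strict Implicit.
Unset Printing Implicit Defensive.

Section MaximalLinkedSystems.

Variable n : nat.

Implicit Types (S T A B C : {set 'I_n}) (F M N E : {set {set 'I_n}}).
Implicit Types (a b i j : 'I_n).

(** * Maximal linked systems: complements, upward closure, kernels and layers *)

Lemma subsetC1 A a : (A \subset ~: [set a]) = (a \notin A).
Proof. by rewrite subsetC sub1set inE. Qed.

Lemma intersectingP F :
  reflect {in F &, forall A B, A :&: B != set0} (intersecting F).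
Proof.
apply: (iffP andP) => [[_ /forall_inP FI] A B /FI/forall_inP|FI]; first exact.
split; first by apply/subsetP => A AF; rewrite inE -[A]setIid FI.
by apply/forall_inP => A AF; apply/forall_inP => B; apply: FI.
Qed.

Lemma mls_intersecting M : is_mls M -> {in M &, forall A B, A :&: B != set0}.
Proof. by case/maxsetP => /intersectingP. Qed.

Lemma mls_neq0 M S : is_mls M -> S \in M -> S != set0.
Proof. by move=> Mm SM; rewrite -[S]setIid (mls_intersecting Mm). Qed.

(** Adjoining such an [S] keeps the family intersecting, so maximality already puts it in [M]. *)
Lemma mls_mem M S :
    is_mls M -> S != set0 -> {in M, forall A, A :&: S != set0} -> S \in M.
Proof.
move=> Mm S0 SM; case/maxsetP: (Mm) => /intersectingP MI Mmax.
rewrite -(Mmax (S |: M)) ?setU11 ?subsetUr //.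
apply/intersectingP => A B /setU1P[->|AM] /setU1P[->|BM]; rewrite ?setIid //.
- by rewrite setIC SM.
- exact: SM.
- exact: MI.
Qed.

(** If [S] is not in [M], some [A] in [M] misses [S] by [mls_mem]; then [A] lies inside [~: S],
    which therefore meets everything that [A] meets. The case of empty [S] is treated apart, since
    [mls_mem] speaks of nonempty sets only. *)
Lemma mls_setC M S : 0 < n -> is_mls M -> (~: S \in M) = (S \notin M).
Proof.
move=> n0 Mm; apply/idP/idP => [CM|SM].
  by apply/negP => SM; have:= mls_intersecting Mm SM CM; rewrite setICr eqxx.
have [S0|Sn0] := eqVneq S set0.
  rewrite S0 setC0; apply: mls_mem => //.
    by apply/set0Pn; exists (Ordinal n0).
  by move=> A AM; rewrite setIT (mls_neq0 Mm).
have /existsP[A /andP[AM /eqP AS]] : [exists A, (A \in M) && (A :&: S == set0)].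
  apply: contraR SM => /existsPn h; apply: mls_mem => // A AM.
  by have := h A; rewrite AM.
have {}AS : A \subset ~: S by rewrite -disjoints_subset -setI_eq0 AS.
apply: mls_mem => // [|B BM].
  have /set0Pn[x xA] := mls_neq0 Mm AM.
  by apply/set0Pn; exists x; rewrite (subsetP AS).
have /set0Pn[x /setIP[xB xA]] := mls_intersecting Mm BM AM.
by apply/set0Pn; exists x; rewrite inE xB (subsetP AS).
Qed.

(** Otherwise [~: S] would belong to [M] and miss [A]. *)
Lemma mls_sub M A S :
  0 < n -> is_mls M -> A \in M -> A \subset S -> S \in M.
Proof.
move=> n0 Mm AM AS; apply: contraLR AM => SM.
rewrite -mls_setC // in SM; apply/negP => AM.
by have := mls_intersecting Mm AM SM; rewrite setI_eq0 disjoints_subset setCK AS.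
Qed.

(** A set of a larger intersecting family that is not in [F] would meet its own complement, which
    lies in [F]. *)
Lemma mlsI F :
    {in F &, forall A B, A :&: B != set0} ->
    (forall S, S \in F \/ ~: S \in F) -> is_mls F.
Proof.
move=> FI FC; apply/maxsetP; split; first exact/intersectingP.
move=> G /intersectingP GI FG; apply/eqP; rewrite eqEsubset FG andbT.
apply/subsetP => S SG; have [//|CF] := FC S.
by have := GI _ _ SG (subsetP FG _ CF); rewrite setICr eqxx.
Qed.

Lemma mls_eq M N : is_mls M -> is_mls N -> M \subset N -> N = M.
Proof. by case/maxsetP => _ Mmax /maxsetP[NI _]; apply: Mmax. Qed.

(** A singleton in [M] forces its point into every member; conversely, a point common to all members
    gives a singleton meeting them all, which is in [M] by maximality. *)
Lemma mls_kernel_free M :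
  is_mls M -> kernel_free M = [forall a, [set a] \notin M].
Proof.
move=> Mm; apply/eqP/forallP => [K0 a|M1].
  apply/negP => aM; suff : a \in \bigcap_(S in M) S by rewrite K0 inE.
  apply/bigcapP => S SM; have /set0Pn[x] := mls_intersecting Mm SM aM.
  by case/setIP=> xS /set1P<-.
apply/setP => a; rewrite inE; apply/negP => /bigcapP aM; have /negP := M1 a.
apply; apply: mls_mem => // [|A /aM aA]; first by rewrite -cards_eq0 cards1.
by apply/set0Pn; exists a; rewrite !inE aA eqxx.
Qed.

(** Complementation maps the [k]-sets outside [M] bijectively onto the [(n - k)]-sets in [M]. *)
Lemma card_layer_compl M k : 0 < n -> is_mls M -> k <= n ->
  #|layer M k| + #|layer M (n - k)| = 'C(n, k).
Proof.
move=> n0 Mm kn; rewrite -[n in 'C(n, _)]card_ord -cardsT -cards_draws.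
rewrite -(cardsID M [set A : {set 'I_n} | A \subset setT & #|A| == k]).
congr (_ + _); first by apply: eq_card => S; rewrite !inE subsetT /= andbC.
rewrite -(card_imset _ (@setC_inj _)); apply: eq_card => S.
rewrite -[S]setCK (mem_imset _ _ (@setC_inj _)) setCK !inE subsetT /=.
have := cardsC S; rewrite card_ord mls_setC //.
by case: (S \in M) => //= SC; apply/eqP/eqP; lia.
Qed.

Lemma Lambda_layers F : Lambda F = \sum_(k < n.+1) #|layer F k| * 2 ^ (n - k).
Proof.
have cardn S : #|S| < n.+1 by rewrite ltnS -[X in _ <= X]card_ord max_card.
rewrite /Lambda (partition_big (fun S => Ordinal (cardn S)) predT) //=.
apply: eq_bigr => k _; rewrite -sum_nat_const.
rewrite [RHS](eq_bigl (fun S => (S \in F) && (Ordinal (cardn S) == k))).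
  by apply: eq_bigr => S /andP[_ /eqP<-].
by move=> S; rewrite inE.
Qed.

(** * Intersecting families of pairs *)

Lemma card2_mem S a : #|S| = 2 -> a \in S ->
  exists2 b, b != a & S = [set a; b].
Proof.
move=> /eqP/cards2P[x [y [xy ->]]] /set2P[] ->; first by exists y; rewrite // eq_sym.
by exists x; rewrite // setUC.
Qed.

(** Take two members [{a, b}] and [{a, c}]. A member missing [a] must contain both [b] and [c], so
    the alternative is decided by whether [{b, c}] is in [E]. *)
Lemma intersecting_pairs E :
    1 < #|E| -> {in E &, forall A B, A :&: B != set0} ->
    (forall S, S \in E -> #|S| = 2) ->
  (exists a, forall S, S \in E -> a \in S) \/ is_triangle E.
Proof.
move=> /card_gt1P[A [A' [AE A'E AA']]] EI E2.
have /set0Pn[a /setIP[aA aA']] := EI _ _ AE A'E.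
have [b ba defA] := card2_mem (E2 _ AE) aA.
have [c ca defA'] := card2_mem (E2 _ A'E) aA'.
have bc : b != c by apply: contraNneq AA' => bc; rewrite defA defA' bc.
have meet x y S : S \in E -> [set x; y] \in E -> (x \in S) || (y \in S).
  by move=> SE /(EI _ _ SE) /set0Pn[z /setIP[zS /set2P[] <-]]; rewrite zS ?orbT.
rewrite defA in AE; rewrite defA' in A'E.
have [bcE|bcE] := boolP ([set b; c] \in E); [right | left].
  have cardT : #|[set a; b; c]| = 3.
    by rewrite -setUA !cardsU1 cards1 !inE (negbTE bc) ![a == _]eq_sym
               (negbTE ba) (negbTE ca).
  (* One inclusion and a count suffice: every member is one of the three pairs, and [E] contains all
     three of them. *)
  exists [set a; b; c] => //; apply/eqP; rewrite eqEcard; apply/andP; split.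
    apply/subsetP => S SE; rewrite inE E2 // eqxx andbT.
    have Ep x y : x != y -> x \in S -> y \in S -> S = [set x; y].
      move=> xy xS yS; apply/esym/eqP.
      by rewrite eqEcard subUset !sub1set xS yS cards2 xy E2.
    have := meet _ _ _ SE AE; have := meet _ _ _ SE A'E; have := meet _ _ _ SE bcE.
    move=> hbc hac hab.
    have : [\/ S = [set a; b], S = [set a; c] | S = [set b; c]].
      case aS: (a \in S) hab hac => /= hab hac.
        case/orP: hbc => ?; [apply: Or31 | apply: Or32];
          by apply: Ep; rewrite // eq_sym.
      by apply: Or33; apply: Ep.
    by case=> ->; apply/subsetP => x; rewrite !inE => /orP[] ->; rewrite ?orbT.
  rewrite cards_draws cardT (_ : 'C(3, 2) = 3) //.
  have <- : #|[set [set a; b]; [set a; c]; [set b; c]]| = 3.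
    rewrite -setUA cardsU1 cards2 !inE.
    have h1 : [set a; b] != [set a; c] by rewrite -defA -defA'.
    have h2 : [set a; b] != [set b; c].
      apply/negP => /eqP/setP/(_ a); rewrite !inE eqxx /= ![a == _]eq_sym.
      by rewrite (negbTE ba) (negbTE ca).
    have h3 : [set a; c] != [set b; c].
      apply/negP => /eqP/setP/(_ a); rewrite !inE eqxx /= ![a == _]eq_sym.
      by rewrite (negbTE ba) (negbTE ca).
    by rewrite (negbTE h1) (negbTE h2) h3.
  by apply: subset_leq_card; rewrite !subUset !sub1set AE A'E bcE.
exists a => S SE; apply: contraNT bcE => aS.
have := meet _ _ _ SE AE; have := meet _ _ _ SE A'E; rewrite (negbTE aS) /=.
move=> cS bS; rewrite (_ : [set b; c] = S) //; apply/eqP.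
by rewrite eqEcard subUset !sub1set bS cS cards2 bc E2.
Qed.

(** * The systems [U_sys i B] *)

Lemma U_sys_mls i B : B != set0 -> is_mls (U_sys i B).
Proof.
move=> B0; apply: mlsI => [A A'|S].
  have BP A1 A2 : A1 :&: B != set0 -> B \subset A2 -> A1 :&: A2 != set0.
    by move=> /set0Pn[x /setIP[xA xB]] /subsetP s; apply/set0Pn; exists x; rewrite inE xA s.
  rewrite !inE => /orP[/andP[iA AB]|/andP[iA AB]] /orP[/andP[iA' A'B]|/andP[iA' A'B]].
  - by apply/set0Pn; exists i; rewrite inE iA.
  - exact: BP.
  - by rewrite setIC BP.
  - by apply: BP => //; rewrite (setIidPr AB).
(* Either [S] meets [B] or [B] lies in [~: S], and likewise with [S] and [~: S] exchanged; the one
   of the two containing [i] decides which form is used. *)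
rewrite !inE; case iS: (i \in S) => /=; rewrite ?orbF.
  by rewrite setI_eq0 disjoint_sym disjoints_subset; apply/orP; case: (_ \subset _).
by rewrite [~: S :&: B]setIC -setDE setD_eq0; apply/orP; case: (_ \subset _).
Qed.

Lemma U_sys_kernel_free i B :
  B \subset ~: [set i] -> 1 < #|B| -> kernel_free (U_sys i B).
Proof.
move=> Bi B2; rewrite mls_kernel_free ?U_sys_mls -?card_gt0 1?ltnW //.
apply/forallP => a; rewrite !inE; have [<-|ia] := eqVneq i a => /=.
  by rewrite orbF negbK setI_eq0 disjoint_sym disjoints_subset.
by apply: contraL B2 => /subset_leq_card; rewrite cards1 -leqNgt.
Qed.

(** A pair is too small to contain [B], so it can enter only through the first clause. *)
Lemma mem_U_sys_pair i j B b : 2 < #|B| ->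
  ([set j; b] \in U_sys i B) = (i \in [set j; b]) && ([set j; b] :&: B != set0).
Proof.
move=> B3; rewrite !inE; case: ((i == j) || _); rewrite /= ?orbF //.
apply/negbTE; apply: contraL B3 => /subset_leq_card; rewrite -leqNgt cards2.
by case: (_ != _) => // /leqW.
Qed.

Lemma layer2_U_sys i B : B \subset ~: [set i] -> 2 < #|B| ->
  layer (U_sys i B) 2 = [set [set i; b] | b in B].
Proof.
move=> Bi B3; apply/setP => S; rewrite inE; apply/andP/imsetP.
  case=> SU /eqP S2; have iS : i \in S.
    apply: contraTT SU => iS; rewrite !inE (negbTE iS) /=.
    by apply: contraL B3 => /subset_leq_card; rewrite S2 -leqNgt.
  have [b bi Sb] := card2_mem S2 iS; exists b => //.
  move: SU; rewrite Sb mem_U_sys_pair // => /andP[_ /set0Pn[x /setIP[/set2P[] ->]]] //.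
  by move=> /(subsetP Bi); rewrite !inE eqxx.
case=> b bB ->; rewrite mem_U_sys_pair // set21 cards2; split.
  by apply/set0Pn; exists b; rewrite !inE eqxx orbT.
by have := subsetP Bi _ bB; rewrite !inE eq_sym => ->.
Qed.

Lemma card_layer2_U_sys i B : B \subset ~: [set i] -> 2 < #|B| ->
  #|layer (U_sys i B) 2| = #|B|.
Proof.
move=> Bi B3; rewrite layer2_U_sys // card_in_imset // => b c bB cB /setP/(_ b).
rewrite !inE eqxx orbT => /esym/orP[/eqP bi|/eqP //].
by have := subsetP Bi _ bB; rewrite bi !inE eqxx.
Qed.

(** The pairs [{i, b}] with [b] in [B] all lie in [U_sys j C], hence contain [j]. If [i] and [j]
    differed, [B] would be contained in [{j}]. *)
Lemma U_sys_inj i j B C :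
    B \subset ~: [set i] -> C \subset ~: [set j] -> 2 < #|B| -> 2 < #|C| ->
  U_sys i B = U_sys j C -> i = j /\ B = C.
Proof.
wlog suff W : i j B C / B \subset ~: [set i] -> C \subset ~: [set j] ->
    2 < #|B| -> 2 < #|C| -> U_sys i B = U_sys j C -> i = j /\ B \subset C.
  move=> Bi Cj B3 C3 eqU; have [ij BC] := W _ _ _ _ Bi Cj B3 C3 eqU.
  have [_ CB] := W _ _ _ _ Cj Bi C3 B3 (esym eqU).
  by split=> //; apply/eqP; rewrite eqEsubset BC.
move=> Bi Cj B3 C3 eqU.
have UC b : b \in B -> [set i; b] \in U_sys j C.
  move=> bB; have : [set i; b] \in layer (U_sys i B) 2.
    by rewrite layer2_U_sys //; apply: imset_f.
  by rewrite eqU inE => /andP[].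
have ij : i = j.
  apply/eqP; apply: contraLR B3 => ij; rewrite -leqNgt.
  suff /subset_leq_card : B \subset [set j] by rewrite cards1 => /leqW.
  apply/subsetP => b /UC; rewrite mem_U_sys_pair // !inE.
  by rewrite eq_sym (negbTE ij) eq_sym => /andP[].
split=> //; apply/subsetP => b /UC; rewrite mem_U_sys_pair // => /andP[_].
case/set0Pn => x /setIP[/set2P[]->] // iC.
by have := subsetP Cj _ iC; rewrite ij !inE eqxx.
Qed.

(** With [B] the whole complement of [a], a set containing [a] misses [B] only if it is [{a}], and a
    set avoiding [a] contains [B] only if it is [B]. *)
Lemma flip_starE a : flip_star a = U_sys a (~: [set a]).
Proof.
apply/setP => S; rewrite !inE [S == ~: _]eqEsubset subsetC sub1set inE.
case aS: (a \in S) => /=; rewrite ?andbF ?orbF //= ?andbT.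
rewrite -setDE setD_eq0 -[S != set0](@in_set _ (fun S => S != set0)) inE.
have -> : S != set0 by apply/set0Pn; exists a.
rewrite andbT; congr negb; apply/eqP/idP => [->|S1]; first exact: subxx.
by apply/eqP; rewrite eqEsubset S1 sub1set.
Qed.

Lemma U_systemsE k : U_systems n k =
  [set U_sys p.1 p.2 | p : 'I_n * {set 'I_n}
     in [set p : 'I_n * {set 'I_n} | (p.2 \subset ~: [set p.1]) && (#|p.2| == k)]].
Proof.
apply/setP => M; rewrite inE; apply/existsP/imsetP.
  by case=> i /existsP[B /and3P[Bi Bk /eqP->]]; exists (i, B); rewrite ?inE ?Bi.
case=> -[i B] /=; rewrite inE => /andP[Bi Bk] ->; exists i.
by apply/existsP; exists B; rewrite Bi Bk eqxx.
Qed.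

(** By [U_sys_inj] the systems are counted by the pairs [(i, B)]. *)
Lemma card_U_systems k : 2 < k -> #|U_systems n k| = n * 'C(n.-1, k).
Proof.
move=> k3; rewrite U_systemsE card_in_imset.
  (* The conjunct [true] gives the condition the shape that [pair_big_dep] expects, with no
     constraint on the first component. *)
  rewrite -sum1_card (eq_bigl (fun p : 'I_n * {set 'I_n} =>
    true && ((p.2 \subset ~: [set p.1]) && (#|p.2| == k)))).
    rewrite -(pair_big_dep predT
      (fun i B => (B \subset ~: [set i]) && (#|B| == k)) (fun _ _ => 1)) /=.
    rewrite (eq_bigr (fun=> 'C(n.-1, k))) ?sum_nat_const ?card_ord // => i _.
    have <- : #|~: [set i]| = n.-1 by rewrite cardsC1 card_ord.
    by rewrite -cards_draws -sum1_card; apply: eq_bigl => B; rewrite inE.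
  by move=> p; rewrite inE.
move=> [i B] [j C]; rewrite !inE /= => /andP[Bi /eqP Bk] /andP[Cj /eqP Ck].
by move=> /U_sys_inj[] //; rewrite ?Bk ?Ck // => -> ->.
Qed.

(** * The balls around a 3-set *)

Lemma ball_mls T : #|T| = 3 -> is_mls (ball T).
Proof.
move=> T3; apply: mlsI => [A B|S]; rewrite !inE.
  (* Two disjoint sets with two points each in [T] would give [T] at least four points. *)
  move=> A2 B2; apply/eqP => AB0; have := cardsUI (A :&: T) (B :&: T).
  rewrite setIACA AB0 set0I cards0 -setIUl.
  by have := subset_leq_card (subsetIr (A :|: B) T); lia.
(* Of the three points of [T], at least two fall on the same side of [S]. *)
by have := cardsID S T; rewrite setDE ![T :&: _]setIC; lia.
Qed.

Lemma ball_kernel_free T : #|T| = 3 -> kernel_free (ball T).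
Proof.
move=> T3; rewrite mls_kernel_free ?ball_mls //; apply/forallP => a.
rewrite inE -ltnNge ltnS -[1](cards1 a).
by rewrite subset_leq_card // subsetIl.
Qed.

Lemma mem_ball2 T S : #|S| = 2 -> (S \in ball T) = (S \subset T).
Proof.
move=> S2; rewrite inE -S2 -[S in RHS]setIT; apply/idP/idP => [h|/setIidPl].
  by rewrite setIT; apply/setIidPl/eqP; rewrite eqEcard subsetIl.
by rewrite setIT => ->.
Qed.

Lemma layer2_ball T :
  layer (ball T) 2 = [set S : {set 'I_n} | (S \subset T) && (#|S| == 2)].
Proof.
apply/setP => S; rewrite inE [RHS]inE.
by have [S2|] := eqVneq #|S| 2; rewrite ?andbF // mem_ball2.
Qed.

Lemma card_layer2_ball T : #|T| = 3 -> #|layer (ball T) 2| = 3.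
Proof. by move=> T3; rewrite layer2_ball cards_draws T3. Qed.

Lemma ball_inj T T' : 1 < #|T| -> 1 < #|T'| -> ball T = ball T' -> T = T'.
Proof.
wlog suff W : T T' / 1 < #|T| -> ball T = ball T' -> T \subset T'.
  by move=> ? ? e; apply/eqP; rewrite eqEsubset !W.
move=> T2 eqT; apply/subsetP => a aT.
have /set0Pn[b /setD1P[ba bT]] : T :\ a != set0.
  by rewrite -card_gt0; have := cardsD1 a T; rewrite aT; lia.
have ab2 : #|[set a; b]| = 2 by rewrite cards2 eq_sym ba.
have : [set a; b] \in ball T by rewrite mem_ball2 // subUset !sub1set aT.
by rewrite eqT mem_ball2 // subUset !sub1set => /andP[].
Qed.

Lemma ballsP M : reflect (exists2 T : {set 'I_n}, #|T| = 3 & M = ball T) (M \in balls n).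
Proof.
rewrite inE; apply: (iffP existsP) => [[T /andP[/eqP T3 /eqP]]|[T T3 ->]].
  by exists T.
by exists T; rewrite T3 !eqxx.
Qed.

Lemma U_systemsP k M :
  reflect (exists i (B : {set 'I_n}), [/\ B \subset ~: [set i], #|B| = k & M = U_sys i B])
          (M \in U_systems n k).
Proof.
rewrite inE; apply: (iffP existsP) => [[i /existsP[B]]|[i [B [Bi Bk ->]]]].
  by case/and3P=> Bi /eqP Bk /eqP ->; exists i, B.
by exists i; apply/existsP; exists B; rewrite Bi Bk !eqxx.
Qed.

Lemma card_balls : #|balls n| = 'C(n, 3).
Proof.
have -> : balls n = [set ball T | T : {set 'I_n} in [set T : {set 'I_n} | #|T| == 3]].
  apply/setP => M; apply/ballsP/imsetP => -[T] T3 ->; exists T => //.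
    by rewrite inE T3.
  by apply/eqP; rewrite inE in T3.
rewrite card_in_imset ?card_draws ?card_ord // => T T'; rewrite !inE.
by move=> /eqP T3 /eqP T3'; apply: ball_inj; rewrite ?T3 ?T3'.
Qed.

(** The pairs [{i, b}] of the ball would all lie in [T], so [T] would contain [i] and [B], at least
    four points. *)
Lemma U_sys_neq_ball i B T : B \subset ~: [set i] -> 2 < #|B| -> #|T| = 3 ->
  U_sys i B <> ball T.
Proof.
move=> Bi B3 T3 eqU.
have iBT : i |: B \subset T.
  have bT b : b \in B -> (i \in T) && (b \in T).
    move=> bB; have : [set i; b] \in layer (U_sys i B) 2.
      by rewrite layer2_U_sys //; apply: imset_f.
    by rewrite eqU layer2_ball inE subUset !sub1set => /andP[].
  rewrite subUset sub1set; apply/andP; split.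
    by have /set0Pn[b /bT/andP[]] : B != set0 by rewrite -card_gt0; lia.
  by apply/subsetP => b /bT/andP[].
have := subset_leq_card iBT; rewrite cardsU1 T3.
by have := Bi; rewrite subsetC1 => ->; rewrite add1n ltnNge B3.
Qed.

(** * Permutations of the ground set and isomorphism types *)

Lemma exists_perm_map (s t : seq 'I_n) :
    uniq s -> uniq t -> size s = n -> size t = n ->
  exists p : {perm 'I_n}, map p s = t.
Proof.
move=> us ut ss st.
(* A duplicate-free list of length [n] contains every point. *)
have sT x : x \in s.
  have [_ ->] := uniq_min_size (s2 := enum 'I_n) us (fun x _ => mem_enum _ x)
    (eq_leq (etrans (size_enum_ord n) (esym ss))).
  by rewrite mem_enum.
have ltx x : index x s < size t by rewrite (etrans st (esym ss)) index_mem.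
(* The map sends each entry of [s] to the entry of [t] at the same position. The default [x] is
   never reached, since the index is below [size t]. *)
have f_inj : injective (fun x => nth x t (index x s)).
  move=> x y; rewrite (set_nth_default x y) // => /eqP.
  rewrite nth_uniq // => /eqP xy.
  by rewrite -(nth_index x (sT x)) xy nth_index.
have [p pE] : exists p : {perm 'I_n}, forall x, p x = nth x t (index x s).
  by exists (perm f_inj) => x; rewrite permE.
have sz : size t = size s by rewrite ss.
exists p; case: t sz {ut st ltx f_inj} pE => [/esym/size0nil-> //|x0 t] sz pE.
apply: (@eq_from_nth _ x0) => [|i]; rewrite size_map ?sz // => lti.
by rewrite (nth_map x0) // pE index_uniq //; apply: set_nth_default; rewrite sz.
Qed.

(** Each set is listed before its complement; the permutation matching the two lists also matches
    their initial parts, which have equal length. *)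
Lemma exists_perm_imset A B : #|A| = #|B| -> exists p : {perm 'I_n}, p @: A = B.
Proof.
move=> cAB; pose e C := enum C ++ enum (~: C).
have ue C : uniq (e C).
  rewrite cat_uniq !enum_uniq andbT; apply/hasPn => x.
  by rewrite /= !mem_enum inE.
have se C : size (e C) = n by rewrite size_cat -!cardE cardsC card_ord.
have [p /eqP] := exists_perm_map (ue A) (ue B) (se A) (se B).
rewrite map_cat eqseq_cat ?size_map -?cardE // => /andP[/eqP mapA _].
exists p; apply/setP => x; rewrite -[RHS]mem_enum -mapA.
by apply/imsetP/mapP => -[y yA ->]; exists y; rewrite ?mem_enum in yA *.
Qed.

Lemma perm_preimsetK (s : {perm 'I_n}) S : s @: (s @^-1: S) = S.
Proof.
by rewrite -im_permV -imset_comp -[RHS]imset_id; apply: eq_imset => x; rewrite /= permKV.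
Qed.

Lemma mem_perm_family (s : {perm 'I_n}) M S :
  (S \in [set [set s x | x in A] | A : {set 'I_n} in M]) = (s @^-1: S \in M).
Proof.
by rewrite -{1}[S](perm_preimsetK s) (mem_imset _ _ (imset_inj (@perm_inj _ s))).
Qed.

Lemma perm_U_sys (s : {perm 'I_n}) i B :
  [set [set s x | x in A] | A : {set 'I_n} in U_sys i B] = U_sys (s i) (s @: B).
Proof.
apply/setP => S; rewrite mem_perm_family !inE -sub_imset_pre; congr (_ && _ || _).
rewrite -!card_gt0 -(card_imset (_ :&: B) (@perm_inj _ s)) imsetI; last first.
  by move=> ? ? _ _; apply: perm_inj.
by rewrite perm_preimsetK.
Qed.

Lemma perm_ball (s : {perm 'I_n}) T :
  [set [set s x | x in A] | A : {set 'I_n} in ball T] = ball (s @: T).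
Proof.
apply/setP => S; rewrite mem_perm_family !inE.
rewrite -(card_imset (_ :&: T) (@perm_inj _ s)) imsetI; last first.
  by move=> ? ? _ _; apply: perm_inj.
by rewrite perm_preimsetK.
Qed.

Lemma isomorphic_sym M N : isomorphic M N -> isomorphic N M.
Proof.
case=> s ->; exists s^-1%g; apply/setP => S; rewrite mem_perm_family.
by rewrite preim_permV (mem_imset _ _ (imset_inj (@perm_inj _ s))).
Qed.

Lemma isomorphic_trans M N F : isomorphic M N -> isomorphic N F -> isomorphic M F.
Proof.
move=> [s ->] [t ->]; exists (s * t)%g; rewrite -imset_comp; apply: eq_imset => S /=.
by rewrite -imset_comp; apply: eq_imset => x; rewrite /= permM.
Qed.

(** A permutation [p] carrying [B] to [C] need not send [i] to [j]. Composing it with the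
    transposition of [p i] and [j] repairs this and fixes [C] pointwise, as [C] contains neither
    point. *)
Lemma U_systems_isomorphic k M N :
  M \in U_systems n k -> N \in U_systems n k -> isomorphic M N.
Proof.
case/U_systemsP => i [B [Bi Bk ->]] /U_systemsP[j [C [Cj Ck ->]]].
have [p pB] := exists_perm_imset (etrans Bk (esym Ck)).
have piC : p i \notin C.
  by rewrite -pB (mem_imset _ _ (@perm_inj _ p)); move: Bi; rewrite subsetC1.
have jC : j \notin C by move: Cj; rewrite subsetC1.
exists (p * tperm (p i) j)%g; rewrite perm_U_sys permM tpermL -pB.
congr (U_sys _ _); apply: eq_in_imset => x xB.
have pxC : p x \in C by rewrite -pB imset_f.
by rewrite permM tpermD //; [apply: contraNneq piC | apply: contraNneq jC] => ->.
Qed.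

Lemma balls_isomorphic M N : M \in balls n -> N \in balls n -> isomorphic M N.
Proof.
case/ballsP => T T3 -> /ballsP[T' T3' ->].
have [p pT] := exists_perm_imset (etrans T3 (esym T3')).
by exists p; rewrite perm_ball pT.
Qed.

(** A permutation turns [U_sys i B] into another system of the same kind, and none of these is a
    ball. *)
Lemma U_systems_not_isomorphic_balls k M N : 2 < k ->
  M \in U_systems n k -> N \in balls n -> ~ isomorphic M N.
Proof.
move=> k3 /U_systemsP[i [B [Bi Bk ->]]] /ballsP[T T3 ->] [s].
rewrite perm_U_sys => /esym; apply: U_sys_neq_ball => //.
  by move: Bi; rewrite !subsetC1 (mem_imset _ _ (@perm_inj _ s)).
by rewrite card_imset ?Bk //; apply: perm_inj.
Qed.

End MaximalLinkedSystems.

(** * Kernel-free systems on five points *)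

Lemma mls5_layers (M : {set {set 'I_5}}) : is_mls M -> kernel_free M ->
  [/\ #|layer M 0| = 0, #|layer M 1| = 0, #|layer M 2| + #|layer M 3| = 10,
      #|layer M 4| = 5 & #|layer M 5| = 1].
Proof.
move=> Mm Mk; have f0 : #|layer M 0| = 0.
  apply/eqP; rewrite cards_eq0 -subset0; apply/subsetP => S.
  by rewrite !inE cards_eq0 => /andP[/(mls_neq0 Mm)/negPf->].
have f1 : #|layer M 1| = 0.
  move: Mk; rewrite mls_kernel_free // => /forallP M1.
  apply/eqP; rewrite cards_eq0 -subset0; apply/subsetP => S.
  by rewrite !inE => /andP[SM /cards1P[a defS]]; have := M1 a; rewrite -defS SM.
(* Complementary layers have total sizes 1, 5 and 10, the binomial coefficients of 5 over 0, 1 and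
   2. *)
have := card_layer_compl (isT : 0 < 5) Mm (isT : 0 <= 5).
have := card_layer_compl (isT : 0 < 5) Mm (isT : 1 <= 5).
have := card_layer_compl (isT : 0 < 5) Mm (isT : 2 <= 5).
by rewrite f0 f1.
Qed.

(** The layers 2 to 5 carry weights 8, 4, 2 and 1, whence [8 f_2 + 4 (10 - f_2) + 2 * 5 + 1]. *)
Lemma mls5_Lambda (M : {set {set 'I_5}}) : is_mls M -> kernel_free M ->
  Lambda M = 51 + 4 * #|layer M 2|.
Proof.
move=> Mm Mk; have [f0 f1 f23 f4 f5] := mls5_layers Mm Mk.
rewrite Lambda_layers !big_ord_recr big_ord0 /= f0 f1 f4 f5 /=.
rewrite !subSS !subn0 !expnS !expn0; move: f23; move: #|layer M 2| #|layer M 3| => x y; lia.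
Qed.

Lemma mls5_profile (M : {set {set 'I_5}}) :
    is_mls M -> kernel_free M -> #|layer M 2| = 3 ->
  profile M = [tuple 0; 3; 7; 5; 1].
Proof.
move=> Mm Mk f2; have [f0 f1 f23 f4 f5] := mls5_layers Mm Mk.
have f3 : #|layer M 3| = 7 by lia.
apply: eq_from_tnth => i; rewrite tnth_mktuple (tnth_nth 0).
by case: i => [[|[|[|[|[|//]]]]] ?].
Qed.

(** By upward closure: a set of the first clause contains some [{a, b}], one of the second contains
    [B]. Maximality later turns this inclusion into equality. *)
Lemma U_sys_sub (n : nat) (M : {set {set 'I_n}}) (a : 'I_n) (B : {set 'I_n}) :
    0 < n -> is_mls M -> B \in M -> (forall b, b \in B -> [set a; b] \in M) ->
  U_sys a B \subset M.
Proof.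
move=> n0 Mm BM abM; apply/subsetP => S; rewrite !inE => /orP[] /andP[aS].
  case/set0Pn => b /setIP[bS bB]; apply: (mls_sub n0 Mm (abM b bB)).
  by rewrite subUset !sub1set aS.
exact: mls_sub.
Qed.

Lemma mls5_classification (M : {set {set 'I_5}}) :
    is_mls M -> kernel_free M -> 2 < #|layer M 2| ->
  [\/ M \in flip_stars 5, M \in U_systems 5 3 | M \in balls 5].
Proof.
move=> Mm Mk f2; set E := layer M 2 in f2.
have EM S : S \in E -> S \in M by rewrite inE => /andP[].
have E2 S : S \in E -> #|S| = 2 by rewrite inE => /andP[_ /eqP].
have EI : {in E &, forall A B, A :&: B != set0}.
  by move=> A B /EM AM /EM BM; apply: mls_intersecting Mm _ _ AM BM.
have [[a aE]|[T T3 defE]] := intersecting_pairs (ltnW f2) EI E2; last first.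
  (* By maximality it suffices that [M] contains the ball, and each set of the ball contains a pair
     of points of [T], which is in [M]. *)
  apply: Or33; apply/ballsP; exists T => //; apply: (mls_eq _ Mm); first exact: ball_mls.
  apply/subsetP => S; rewrite inE => /card_gt1P[x [y [/setIP[xS xT] /setIP[yS yT] xy]]].
  apply: (mls_sub (A := [set x; y]) (isT : 0 < 5) Mm); last by rewrite subUset !sub1set xS.
  by apply: EM; rewrite defE inE subUset !sub1set xT yT cards2 xy.
pose B : {set 'I_5} := [set b : 'I_5 | [set a; b] \in E].
have Ba : B \subset ~: [set a].
  by rewrite subsetC1 inE; apply/negP => /E2; rewrite setUid cards1.
have cardB : #|B| = #|E|.
  have <- : [set [set a; b] | b in B] = E.
    apply/setP => S; apply/imsetP/idP => [[b] | SE]; first by rewrite inE => ? ->.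
    have [b ba defS] := card2_mem (E2 _ SE) (aE _ SE).
    by exists b; rewrite // inE -defS.
  rewrite card_in_imset // => b c; rewrite !inE => bE cE /setP/(_ b).
  rewrite !inE eqxx orbT => /esym/orP[/eqP ba|/eqP //].
  by case/andP: bE; rewrite ba setUid cards1.
have B3 : 2 < #|B| by rewrite cardB.
(* Otherwise [~: B] is in [M]; it contains [a] and has at most two points. It is not [{a}], since
   [M] is kernel-free, and if it were [{a, d}], then [d] would belong to [B]. *)
have BM : B \in M.
  rewrite -[B]setCK mls_setC //; apply/negP => CM.
  have aC : a \in ~: B by rewrite inE -subsetC1.
  have cC : #|~: B| <= 2 by have := cardsC B; rewrite card_ord; lia.
  have C2 : #|~: B| = 2.
    apply/eqP; rewrite eqn_leq cC ltnNge; apply/negP => C1.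
    have defC : ~: B = [set a] by apply/esym/eqP; rewrite eqEcard sub1set aC cards1.
    by move: Mk; rewrite mls_kernel_free // => /forallP/(_ a); rewrite -defC CM.
  have [d da defC] := card2_mem C2 aC.
  have : d \in ~: B by rewrite defC !inE eqxx orbT.
  by rewrite !inE -defC CM C2.
have defM : M = U_sys a B.
  apply: (mls_eq _ Mm); first by rewrite U_sys_mls // -card_gt0 (leq_trans _ B3).
  by apply: U_sys_sub => // b; rewrite inE => /EM.
have B4 : #|B| <= 4.
  by have := subset_leq_card Ba; rewrite cardsC1 card_ord.
have [B4'|B4'] := eqVneq #|B| 4.
  have defB : B = ~: [set a] by apply/eqP; rewrite eqEcard Ba cardsC1 card_ord B4'.
  by apply: Or31; apply/imsetP; exists a; rewrite // flip_starE -defB.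
by apply: Or32; apply/U_systemsP; exists a, B; split=> //; lia.
Qed.

(** * The second level on five points *)

Lemma flip_star_layer2 (M : {set {set 'I_5}}) :
  M \in flip_stars 5 -> #|layer M 2| = 4.
Proof.
case/imsetP => a _ ->.
by rewrite flip_starE card_layer2_U_sys ?cardsC1 ?card_ord.
Qed.

Lemma U_systems5P (M : {set {set 'I_5}}) : M \in U_systems 5 3 ->
  [/\ is_mls M, kernel_free M & #|layer M 2| = 3].
Proof.
case/U_systemsP => i [B [Bi B3 ->]].
by rewrite U_sys_mls ?U_sys_kernel_free ?card_layer2_U_sys -?card_gt0 ?B3.
Qed.

Lemma balls5P (M : {set {set 'I_5}}) : M \in balls 5 ->
  [/\ is_mls M, kernel_free M & #|layer M 2| = 3].
Proof.
case/ballsP => T T3 ->.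
by rewrite ball_mls ?ball_kernel_free ?card_layer2_ball.
Qed.

Lemma U_systems5_neq0 : exists M, M \in U_systems 5 3.
Proof. by apply/set0Pn; rewrite -card_gt0 card_U_systems. Qed.

Lemma balls5_neq0 : exists M, M \in balls 5.
Proof. by apply/set0Pn; rewrite -card_gt0 card_balls. Qed.

(** Four or more pairs leave only flip stars, so [f_2] is at most 3 and [Lambda] at most [51 + 12];
    any ball attains this bound. *)
Lemma second_level_value5 : second_level_value 5 = 63.
Proof.
apply/eqP; rewrite eqn_leq; apply/andP; split.
  apply/bigmax_leqP => M /and3P[Mm Mk Mf]; rewrite mls5_Lambda //.
  suff : #|layer M 2| <= 3 by lia.
  rewrite leqNgt; apply/negP => f2.
  have [MF|/U_systems5P[_ _]|/balls5P[_ _]] := mls5_classification Mm Mk (ltnW f2).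
  - by rewrite MF in Mf.
  - by move=> f3; rewrite f3 in f2.
  - by move=> f3; rewrite f3 in f2.
have [M /balls5P[Mm Mk f2]] := balls5_neq0.
have <- : Lambda M = 63 by rewrite mls5_Lambda // f2.
apply: leq_bigmax_cond; rewrite Mm Mk /=.
by apply/negP => /flip_star_layer2; rewrite f2.
Qed.

(** The equation [51 + 4 f_2 = 63] means [f_2 = 3], which also keeps out the flip stars, where
    [f_2 = 4]. *)
Lemma second_level5P M :
  reflect [/\ is_mls M, kernel_free M & #|layer M 2| = 3] (M \in second_level 5).
Proof.
rewrite inE second_level_value5; apply: (iffP and3P) => -[Mm Mk].
  by rewrite mls5_Lambda // => /eqP f2; split=> //; lia.
by move=> f2; split=> //; rewrite mls5_Lambda // f2.
Qed.

Lemma second_level5E : second_level 5 = U_systems 5 3 :|: balls 5.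
Proof.
apply/setP => M; rewrite in_setU; apply/second_level5P/orP; last first.
  by case=> [/U_systems5P|/balls5P].
case=> Mm Mk f2; have f3 : 2 < #|layer M 2| by rewrite f2.
have [/flip_star_layer2|MU|MB] := mls5_classification Mm Mk f3.
- by rewrite f2.
- by left.
- by right.
Qed.

Lemma profile5_constant M N : M \in U_systems 5 3 -> N \in balls 5 ->
  profile M = profile N.
Proof.
by move=> /U_systems5P[? ? ?] /balls5P[? ? ?]; rewrite !mls5_profile.
Qed.

Lemma U_systems_balls_disjoint (n k : nat) M : 2 < k ->
  M \in U_systems n k -> M \notin balls n.
Proof.
move=> k3 /U_systemsP[i [B [Bi Bk ->]]]; apply/negP => /ballsP[T T3].
by apply: U_sys_neq_ball => //; rewrite Bk.
Qed.

Theorem proposition5p6 :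
  [/\ #|flip_stars 5| = 5 /\ second_level_value 5 = 63,
      [/\ #|second_level 5| = 30,
          second_level 5 = U_systems 5 3 :|: balls 5,
          #|U_systems 5 3| = 20
        & #|balls 5| = 10],
      (forall M, M \in second_level 5 ->
         profile M = [tuple 0; 3; 7; 5; 1] :> 5.-tuple nat),
      [/\ (forall M, M \in U_systems 5 3 -> is_star3 (layer M 2)),
          (forall M, M \in balls 5 -> is_triangle (layer M 2)),
          (forall M N, M \in U_systems 5 3 -> N \in U_systems 5 3 ->
             isomorphic M N),
          (forall M N, M \in balls 5 -> N \in balls 5 -> isomorphic M N)
        & (forall M N, M \in U_systems 5 3 -> N \in balls 5 ->
             ~ isomorphic M N)]
    & [/\ (forall (X : Type) (f : 5.-tuple nat -> X)
             (M N : {set {set 'I_5}}),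
             M \in U_systems 5 3 -> N \in balls 5 ->
             f (profile M) = f (profile N)),
          ~ (exists P : 5.-tuple nat -> Prop,
               profile_recognises (U_systems 5 3) P),
          ~ (exists P : 5.-tuple nat -> Prop,
               profile_recognises (balls 5) P)
        & ~ (exists g : 5.-tuple nat -> {set {set 'I_5}},
               profile_classifies g)]].

Proof.
(* One system of each type, with equal profiles: this single pair refutes all three kinds of profile
   criterion. *)
have [M0 M0U] := U_systems5_neq0; have [N0 N0B] := balls5_neq0.
have M0L : M0 \in second_level 5 by rewrite second_level5E in_setU M0U.
have N0L : N0 \in second_level 5 by rewrite second_level5E in_setU N0B orbT.
have eqp := profile5_constant M0U N0B.
have M0B : M0 \notin balls 5 by apply: U_systems_balls_disjoint M0U.
have N0U : N0 \notin U_systems 5 3.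
  by apply: contraL N0B => /U_systems_balls_disjoint; apply.
split; first split.
- rewrite /flip_stars card_imset ?card_ord // => a b.
  rewrite !flip_starE => /U_sys_inj[] //; by rewrite cardsC1 card_ord.
- exact: second_level_value5.
- have cU : #|U_systems 5 3| = 20 by rewrite card_U_systems.
  have cB : #|balls 5| = 10 by rewrite card_balls.
  split=> //; last exact: second_level5E.
  rewrite second_level5E cardsU cU cB.
  rewrite (_ : _ :&: _ = set0) ?cards0 //; apply/setP => M; rewrite in_setI in_set0.
  by apply/negP => /andP[/(U_systems_balls_disjoint (isT : 2 < 3))/negP].
- by move=> M /second_level5P[]; apply: mls5_profile.
- split.
  + move=> M MU; have [_ _ f2] := U_systems5P MU; split=> // [S|].
      by rewrite inE => /andP[_ /eqP].
    case/U_systemsP: MU => i [B [Bi B3 ->]]; exists i => S.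
    by rewrite layer2_U_sys ?B3 // => /imsetP[b _ ->]; rewrite set21.
  + by move=> _ /ballsP[T T3 ->]; exists T; rewrite ?layer2_ball.
  + exact: U_systems_isomorphic.
  + exact: balls_isomorphic.
  + by move=> M N; apply: U_systems_not_isomorphic_balls.
split.
- by move=> X f M N MU NB; rewrite (profile5_constant MU NB).
(* [P] holds at the profile of [M0], hence at that of [N0], which would put [N0] among the [U_sys]
   systems; the next case runs in the opposite direction. *)
- by case=> P PU; move: N0U; rewrite -(rwP negP); apply; apply/PU => //; rewrite -eqp; apply/PU.
- by case=> P PB; move: M0B; rewrite -(rwP negP); apply; apply/PB => //; rewrite eqp; apply/PB.
(* The value of [g] at the common profile would be isomorphic to both [M0] and [N0]. *)
- case=> g gP; apply: (U_systems_not_isomorphic_balls _ M0U N0B) => //.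
  by apply: isomorphic_trans (gP _ M0L) _; rewrite eqp; apply/isomorphic_sym/gP.
Qed.
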